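(* Let $T:V\to A$ be a relative Rota-Baxter operator on a left pre-Jacobi-Jordan algebra $(A,\cdot)$ with respect to a representation $(V,\rho,\mu)$. If two linear deformations $T_t^1=T+tJ_1$ and $T_t^2=T+tJ_2$ of $T$ are equivalent, then $J_1$ and $J_2$ are in the same cohomology class, i.e. $J_2-J_1\in B^1(V,A)$.
   Context: All vector spaces are finite dimensional over a field $\mathbb{K}$ of characteristic $0$; an algebra is a vector space with a bilinear product, not assumed associative. A left pre-Jacobi-Jordan algebra is an algebra $(A,\cdot)$ whose anti-associator $Aasso(x,y,z):=(x\cdot y)\cdot z+x\cdot(y\cdot z)$ satisfies $Aasso(x,y,z)=-Aasso(y,x,z)$. A representation $(V,\rho,\mu)$ of $(A,\cdot)$ is a vector space $V$ with linear maps $\rho,\mu:A\to gl(V)$ such that for all $x,y\in A$ $$\rho(x\cdot y+y\cdot x)=-\rho(x)\rho(y)-\rho(y)\rho(x),\qquad \mu(y)\mu(x)+\mu(x\cdot y)=-\mu(y)\rho(x)-\rho(x)\mu(y).$$ A linear map $T:V\to A$ is a relative Rota-Baxter operator with respect to $(V,\rho,\mu)$ if $T(u)\cdot T(v)=T(\rho(Tu)v+\mu(Tv)u)$ for all $u,v\in V$. A linear deformation of $T$ is a family $T_t=T+tJ$ with $J:V\to A$ linear such that $T_t$ is a relative Rota-Baxter operator with respect to $(V,\rho,\mu)$ for all $t\in\mathbb{K}$. A morphism from a relative Rota-Baxter operator $T'$ to a relative Rota-Baxter operator $T$ (both with respect to $(V,\rho,\mu)$) is a pair $(\phi_A,\phi_V)$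 with $\phi_A:A\to A$ a left pre-Jacobi-Jordan algebra morphism and $\phi_V:V\to V$ linear such that $T\circ\phi_V=\phi_A\circ T'$, and $\phi_V\circ\rho(x)=\rho(\phi_A(x))\circ\phi_V$, $\phi_V\circ\mu(x)=\mu(\phi_A(x))\circ\phi_V$ for all $x\in A$. For $u,v\in V$, $x\in A$ put $u\cdot_T v=\rho(Tu)v+\mu(Tv)u$, $\rho_T(v)x=Tv\cdot x-T(\mu(x)v)$, $\mu_T(v)x=x\cdot Tv-T(\rho(x)v)$, and let $$C^0(V,A):=\{x\in A:\ \rho_T(u\cdot_T v)x+\rho_T(u)\rho_T(v)x=0\ \ \forall u,v\in V\}.$$ Write $L_x(y)=x\cdot y$, $R_x(y)=y\cdot x$. Two linear deformations $T_t^1=T+tJ_1$ and $T_t^2=T+tJ_2$ of $T$ are equivalent if there exists $x\in C^0(V,A)$ such that, for all $t\in\mathbb{K}$, $(Id_A+tL_x+tR_x,\,Id_V+t\rho(x)+t\mu(x))$ is a morphism from $T_t^2$ to $T_t^1$. The degree-zero differential $\delta_T^0:C^0(V,A)\to\mathrm{Hom}(V,A)$ is $\delta^0_T(x)(u):=\rho_T(u)x+\mu_T(u)x$, and $B^1(V,A)$ denotes its image (the $1$-coboundaries). Two linear maps $V\to A$ are in the same cohomology class if their difference lies in $B^1(V,A)$. *)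

(* Defs.v *)
From HB Require Import structures.
From mathcomp Require Import all_boot all_algebra.

Set Implicit Arguments.
Unset Strict Implicit.
Unset Printing Implicit Defensive.

Import GRing.Theory.
Local Open Scope ring_scope.

(* A bilinear product on A is given in curried form, as a linear map
   [mul : 'Hom(A, 'End(A))] with x . y = mul x y; thus [mul x] is the left
   multiplication L_x.  Likewise a linear map A -> gl(V) is an element of
   'Hom(A, 'End(V)). *)

Section Algebra.

Variables (K : fieldType) (A : vectType K) (mul : 'Hom(A, 'End(A))).

Definition anti_associator (x y z : A) : A :=
  mul (mul x y) z + mul x (mul y z).

Definition left_pre_Jacobi_Jordan : Prop :=
  forall x y z : A, anti_associator x y z = - anti_associator y x z.

Definition algebra_morphism (f : 'End(A)) : Prop :=
  forall x y : A, f (mul x y) = mul (f x) (f y).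

(* [linfun] is only meaningful on linear functions: see [right_mulE]. *)
Definition right_mul (x : A) : 'End(A) := linfun (fun y : A => mul y x).

Lemma right_mulE (x y : A) : right_mul x y = mul y x.
Proof.
have lin : linear (fun y : A => mul y x).
  by move=> a u v; rewrite linearP add_lfunE scale_lfunE.
pose h := GRing.isLinear.Build _ _ _ _ _ lin.
pose f : {linear A -> A} := HB.pack (fun y : A => mul y x) h.
exact: (lfunE f y).
Qed.

End Algebra.

Section RotaBaxter.

Variables (K : fieldType) (A V : vectType K).
Variables (mul : 'Hom(A, 'End(A))) (rho mu : 'Hom(A, 'End(V))).

Definition representation : Prop :=
  (forall x y : A,
     rho (mul x y + mul y x)
     = - (rho x \o rho y)%VF - (rho y \o rho x)%VF) /\
  (forall x y : A,
     (mu y \o mu x)%VF + mu (mul x y)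
     = - (mu y \o rho x)%VF - (rho x \o mu y)%VF).

Definition relative_Rota_Baxter (T : 'Hom(V, A)) : Prop :=
  forall u v : V, mul (T u) (T v) = T (rho (T u) v + mu (T v) u).

Definition linear_deformation (T J : 'Hom(V, A)) : Prop :=
  forall t : K, relative_Rota_Baxter (T + t *: J).

Definition RB_morphism (T' T : 'Hom(V, A)) (phiA : 'End(A)) (phiV : 'End(V))
  : Prop :=
  [/\ algebra_morphism mul phiA,
      (T \o phiV)%VF = (phiA \o T')%VF,
      forall x : A, (phiV \o rho x)%VF = (rho (phiA x) \o phiV)%VF
    & forall x : A, (phiV \o mu x)%VF = (mu (phiA x) \o phiV)%VF].

Variable T : 'Hom(V, A).

Definition dotT (u v : V) : V := rho (T u) v + mu (T v) u.
Definition rhoT (v : V) (x : A) : A := mul (T v) x - T (mu x v).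
Definition muT (v : V) (x : A) : A := mul x (T v) - T (rho x v).

Definition C0 (x : A) : Prop :=
  forall u v : V, rhoT (dotT u v) x + rhoT u (rhoT v x) = 0.

(* Defined for every x in A, but only used on C0. *)
Definition delta0 (x : A) : 'Hom(V, A) :=
  linfun (fun u : V => rhoT u x + muT u x).

Lemma delta0E (x : A) (u : V) : delta0 x u = rhoT u x + muT u x.
Proof.
have lin : linear (fun u : V => rhoT u x + muT u x).
  move=> a v w; rewrite /rhoT /muT !linearP add_lfunE scale_lfunE.
  have E (p q r s p1 q1 r1 s1 : A) :
      a *: p + p1 + (a *: q + q1) + (a *: r + r1 + (a *: s + s1))
      = a *: (p + q + (r + s)) + (p1 + q1 + (r1 + s1)).
    rewrite !scalerDr (addrACA (a *: p)) (addrACA (a *: r)).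
    exact: addrACA.
  exact: E.
pose h := GRing.isLinear.Build _ _ _ _ _ lin.
pose f : {linear V -> A} := HB.pack (fun u : V => rhoT u x + muT u x) h.
exact: (lfunE f u).
Qed.

Definition B1 (f : 'Hom(V, A)) : Prop := exists2 x : A, C0 x & f = delta0 x.

Definition same_cohomology_class (f g : 'Hom(V, A)) : Prop := B1 (g - f).

Definition equivalent_deformations (J1 J2 : 'Hom(V, A)) : Prop :=
  exists2 x : A, C0 x &
    forall t : K,
      RB_morphism (T + t *: J2) (T + t *: J1)
        (\1%VF + t *: mul x + t *: right_mul mul x)
        (\1%VF + t *: rho x + t *: mu x).

End RotaBaxter.

(* Main.v *)
Require Import Defs.
From HB Require Import structures.
From mathcomp Require Import all_boot all_algebra.
Import GRing.Theory.
Local Open Scope ring_scope.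

(* The coefficient of [t] in the intertwining condition
   [T^1_t o (1 + t rho x + t mu x) = (1 + t L_x + t R_x) o T^2_t]
   is [J2 - J1 = delta0 (- x)]. *)

(** Evaluated at [u], both sides of the intertwining condition are quadratic in [t] with the same
    constant term [T u]. Characteristic 0 allows the linear coefficients to be compared
    ([coeff1_eq0]), which gives [infinitesimal_equivalence]. The sign is absorbed into the cochain:
    [- x] stays in [C0] and [delta0] is odd ([C0N], [delta0N]). *)

(** The values at [t = 1] and [t = -1] give [a + b = 0] and [b - a = 0], hence [2 a = 0]. *)
Lemma coeff1_eq0 (K : fieldType) (U : lmodType K) (a b : U) :
    (2%:R : K) != 0 -> (forall t : K, t *: a + t ^+ 2 *: b = 0) -> a = 0.
Proof.
move=> two_neq0 ab0; have := ab0 1; have := ab0 (- 1).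
rewrite sqrrN expr1n scaleN1r !scale1r => /eqP.
rewrite addrC subr_eq0 => /eqP -> /eqP.
by rewrite -mulr2n -scaler_nat scaler_eq0 (negPf two_neq0) => /eqP.
Qed.

(** Bookkeeping for the expanded condition: [z] is the constant term [T u], which cancels. *)
Lemma sub_cancel_addl (U : zmodType) (z a b c d e f : U) :
  a - b + (c - d) + (e - f) = z + a + (c + e) + (- z - d + (- b - f)).
Proof.
rewrite [RHS]addrACA (addrACA z) subrr add0r (addrACA c) [RHS]addrA.
by congr (_ + _); rewrite [LHS]addrACA [RHS]addrACA [- d - b]addrC.
Qed.

Section RotaBaxterCochains.

Variables (K : fieldType) (A V : vectType K).
Variables (mul : 'Hom(A, 'End(A))) (rho mu : 'Hom(A, 'End(V))).
Variable T : 'Hom(V, A).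

Lemma rhoTN (v : V) (x : A) :
  rhoT mul mu T v (- x) = - rhoT mul mu T v x.
Proof. by rewrite /rhoT !raddfN opp_lfunE raddfN opprD. Qed.

Lemma muTN (v : V) (x : A) : muT mul rho T v (- x) = - muT mul rho T v x.
Proof. by rewrite /muT !raddfN !opp_lfunE raddfN opprD. Qed.

Lemma C0N (x : A) : C0 mul rho mu T x -> C0 mul rho mu T (- x).
Proof. by move=> C0x u v; rewrite !rhoTN -opprD C0x oppr0. Qed.

Lemma delta0N (x : A) :
  delta0 mul rho mu T (- x) = - delta0 mul rho mu T x.
Proof.
by apply/lfunP => u; rewrite opp_lfunE !delta0E rhoTN muTN -opprD.
Qed.

Lemma infinitesimal_equivalence (J1 J2 : 'Hom(V, A)) (x : A) :
    (2%:R : K) != 0 ->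
    (forall t : K,
       ((T + t *: J1) \o (\1 + t *: rho x + t *: mu x))%VF
       = ((\1 + t *: mul x + t *: right_mul mul x) \o (T + t *: J2))%VF) ->
  J2 - J1 = - delta0 mul rho mu T x.
Proof.
move=> two_neq0 intertw; apply/eqP; rewrite -addr_eq0; apply/eqP/lfunP => u.
rewrite zero_lfunE.
(* At [u], the morphism is [y |-> y + t w(y)] on [A] and [u |-> u + t p] on [V]. *)
pose w := mul x + right_mul mul x; pose p := rho x u + mu x u.
have deltaE : delta0 mul rho mu T x u = w (T u) - T p.
  rewrite delta0E /rhoT /muT /w /p add_lfunE right_mulE linearD opprD.
  by rewrite addrC addrACA.
have phiAE t y :
    (\1%VF + t *: mul x + t *: right_mul mul x) y = y + t *: w y.
  by rewrite !add_lfunE !scale_lfunE id_lfunE scalerDr addrA.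
have phiVE t : (\1%VF + t *: rho x + t *: mu x) u = u + t *: p.
  by rewrite !add_lfunE !scale_lfunE id_lfunE scalerDr addrA.
clearbody w p.
(* The given vector is the coefficient of [t ^+ 2] in the difference of the two sides. *)
apply: (@coeff1_eq0 K A _ (w (J2 u) - J1 p)) => // t.
(* The zero of the goal becomes that difference, leaving an identity to expand. *)
move/lfunP/(_ u)/esym/eqP: (intertw t); rewrite -subr_eq0 => /eqP <-.
rewrite !comp_lfunE phiAE phiVE !add_lfunE !scale_lfunE opp_lfunE deltaE.
rewrite !(linearD, linearZ) /= !scalerDr !scalerN.
rewrite !scalerA -!expr2.
exact: sub_cancel_addl.
Qed.

End RotaBaxterCochains.

Theorem theorem4p20 (K : fieldType) (charK0 : [pchar K] =i pred0)
    (A V : vectType K) (mul : 'Hom(A, 'End(A))) (rho mu : 'Hom(A, 'End(V)))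
    (T J1 J2 : 'Hom(V, A))
    (mulP : left_pre_Jacobi_Jordan mul)
    (rhomuP : representation mul rho mu)
    (TP : relative_Rota_Baxter mul rho mu T)
    (T1P : linear_deformation mul rho mu T J1)
    (T2P : linear_deformation mul rho mu T J2)
    (T12 : equivalent_deformations mul rho mu T J1 J2) :
  same_cohomology_class mul rho mu T J1 J2.
Proof.
have two_neq0 : (2%:R : K) != 0 by have := charK0 2; rewrite !inE /= => ->.
have [x C0x morph] := T12.
exists (- x); first exact: C0N.
rewrite delta0N; apply: infinitesimal_equivalence => // t.
by have [] := morph t.
Qed.
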